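(* Let Assumptions A1F, A2F, A3, A4, A5, A6 (stated in the context) hold. At every iteration $k\ge0$ let the reference point be chosen as follows: - ${\bf u}_{k^*}$ is given by the solution $k^*$ of Problem (Ref) (or of Problem (Ref-num) when the cost is numerical) if such a solution exists; - if Problem (Ref) (resp. (Ref-num)) is infeasible, ${\bf u}_{k^*}:={\bf u}_0$. Let ${\bf u}_{k+1}:={\bf u}_{k^*}+K_k(\bar{\bf u}_{k+1}^*-{\bf u}_{k^*})$, with $\bar{\bf u}_{k+1}^*$ computed by Algorithm 3F and $K_k$ chosen as follows: - $K_k$ is the solution of Problem (LS1) (resp. of (LS1-num), for a numerical cost) if such a solution exists; - if (LS1) (resp. (LS1-num)) is infeasible, $K_k$ is the solution of Problem (LS2) (resp. of (LS2-num)) if such a solution exists; - if both are infeasible, $K_k:=0$. In the case that the resulting ${\bf u}_{k+1}$ is not sufficiently exciting with respect to user specifications, it is replaced with some other ${\bf u}_{k+1}\in\mathcal B_{e,k^*}$. If the slack update law $$d_{p,j}^0:=\overline d_{p,j},\quad d_j^0:=\overline d_j,\quad d_{p,j}^{k+1}:=\begin{cases}\beta_{p,j}d_{p,j}^k,&\overline g_{p,j}({\bf u}_k,\tau_k)>0\\ d_{p,j}^k,&\overline g_{p,j}({\bf u}_k,\tau_k)\le0\end{cases},\quad d_j^{k+1}:=\begin{cases}\beta_jd_j^k,&g_j({\bf u}_k)>0\\ d_j^k,&g_j({\bf u}_k)\le0\end{cases}$$ is applied, with slack-reduction constants satisfying $\beta_{p,j}\le(d_{p,j}^S-\overline d_{p,j})/d_{p,j}^S$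 and $\beta_j\le(d_j^S-\overline d_j)/d_j^S$, then the bounds $$\sum_{\bar k=0}^\infty\max[0,g_{p,j}({\bf u}_{\bar k},\tau_{\bar k})]\le d_{p,j}^S\ (j=1,\dots,n_{g_p}),\qquad \sum_{\bar k=0}^\infty\max[0,g_j({\bf u}_{\bar k})]\le d_j^S\ (j=1,\dots,n_g)$$ hold almost surely for all $j$, with ${\bf u}^L\preceq{\bf u}_k\preceq{\bf u}^U$ for all $k$.
   Context: **Problem.** Minimize over ${\bf u}\in\mathbb R^{n_u}$ an experimental cost $\phi_p({\bf u},\tau)$ (or a known numerical cost $\phi({\bf u})$) subject to experimental constraints $g_{p,j}({\bf u},\tau)\le0$ ($j=1,\dots,n_{g_p}$), known numerical constraints $g_j({\bf u})\le0$ ($j=1,\dots,n_g$), and ${\bf u}^L\preceq{\bf u}\preceq{\bf u}^U$. Here $\tau$ is time. $\mathcal I=\{{\bf u}:{\bf u}^L\preceq{\bf u}\preceq{\bf u}^U\}$, $\mathcal I_\tau=\mathcal I\times[\tau_0,\overline\tau]$, $\overline\tau<\infty$. Experiments are run at points ${\bf u}_0,{\bf u}_1,\dots$ at times $\tau_0\le\tau_1\le\dots\le\overline\tau$. Constants: $\delta_e>0$; ${\bf 1}$ is the all-ones vector; $\overline d_{p,j},\overline d_j\ge0$; $\beta_{p,j},\beta_j\in[0,1)$; $d_{p,j}^S,d_j^S>0$. **Estimates.** Measurements are noisy. From the data available at iteration $k$ one has numbers $\overline g_{p,j}({\bf u}_{\bar k},\tau_{\bar k})$ (upper bounds on constraint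 values), $\underline\phi_p({\bf u}_{\bar k},\tau_{\bar k}),\overline\phi_p({\bf u}_{\bar k},\tau_{\bar k})$ (lower/upper bounds on cost values), and gradient estimates with lower/upper bounds, denoted $\nabla\hat g_{p,j},\nabla\underline g_{p,j},\nabla\overline g_{p,j}$ and $\nabla\hat\phi_p,\nabla\underline\phi_p,\nabla\overline\phi_p$ (gradients are with respect to $({\bf u},\tau)$; components are written $\partial\underline g_{p,j}/\partial u_i$, $\partial\overline g_{p,j}/\partial\tau$, etc.). These are available at any required point. **Local sets.** (bbox = minimal axis-aligned bounding box.) $\mathcal I_\tau^{\bar k}=\mathrm{bbox}({\bf u}_{\bar k},{\bf u}_{k^*},\bar{\bf u}_{k+1}^* )\times[\min(\tau_{\bar k},\tau_{k^*}),\tau_{k+1}]$; for $\bar k_1\le\bar k_2$, $\mathcal I_\tau^{\bar k_1,\bar k_2}=\mathrm{bbox}({\bf u}_{\bar k_1},{\bf u}_{\bar k_2})\times[\tau_{\bar k_1},\tau_{\bar k_2}]$; $\mathcal B_{e,\bar k}=\{{\bf u}:\|{\bf u}-{\bf u}_{\bar k}\|_2\le\delta_e\}$; $\mathcal I_\tau^{e,\bar k}=\mathcal B_{e,\bar k}\times[\tau_{\bar k},\tau_{k+1}]$. For $K\in[0,1]$ write ${\bf x}_K={\bf u}_{k^*}+K(\bar{\bf u}_{k+1}^*-{\bf u}_{k^*})$ with components $x_{K,i}$; $\mathcal B_K=\{{\bf u}:\|{\bf u}-{\bf x}_K\|_2\le\delta_e\}$; $\mathcal I_\tau^K=\mathcal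 B_K\times[\tau_{k+1},\tau_{k+2}]$. **Lipschitz constants.** The user supplies global constants $\underline\kappa_{p,ji},\overline\kappa_{p,ji},\underline\kappa_{p,j\tau},\overline\kappa_{p,j\tau}$ and local versions with superscripts $\bar k$; $\bar k_1,\bar k_2$; $e,\bar k$; $K$, associated with $\mathcal I_\tau^{\bar k}$, $\mathcal I_\tau^{\bar k_1,\bar k_2}$, $\mathcal I_\tau^{e,\bar k}$, $\mathcal I_\tau^K$ respectively. They are *correct* if on the associated set ($\mathcal I_\tau$ for the global constants) the lower and upper constants for $u_i$ strictly bound $\partial g_{p,j}/\partial u_i$ from below and above, the lower and upper constants for $\tau$ (weakly) bound $\partial g_{p,j}/\partial\tau$ from below and above, and each local lower (upper) constant is $\ge$ ($\le$) the corresponding global one. Analogous constants $\underline\kappa_{\phi,i},\overline\kappa_{\phi,i},\underline\kappa_{\phi,\tau},\overline\kappa_{\phi,\tau}$ (bounds on first derivatives of $\phi_p$) and $\underline M_{\phi,i_1i_2},\overline M_{\phi,i_1i_2}$ (bounds on $\partial^2\phi_p/\partial u_{i_2}\partial u_{i_1}$), with local versions, are supplied for the cost. **Concavity/convexity indicators.** For each of the sets above (same superscripts; no superscript for $\mathcal I_\tau$), $I_{c,j}\subseteq\{1,\dots,n_u\}$ is the index set of a subvector ${\bf z}$ of ${\bf u}$ such that $g_{p,j}$ is concave in ${\bf z}$ on the set for the other variables ${\bf v}$ and $\tau$ fixed; $\eta_{c,j}\in\{0,1\}$ is $1$ if $g_{p,j}$ is concave jointly in $({\bf z},\tau)$ on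 the set for ${\bf v}$ fixed, and $0$ otherwise. Similarly $I_{c,\phi},\eta_{c,\phi}$ (concavity) and $I_{v,\phi},\eta_{v,\phi}$ (convexity) for $\phi_p$. **Back-off vectors.** $\kappa_{p,j}^{m,\bar k}\in\mathbb R^{n_u}$ has components $\max\big[|\partial\underline g_{p,j}/\partial u_i|_{({\bf u}_{\bar k},\tau_{\bar k})}|,|\partial\overline g_{p,j}/\partial u_i|_{({\bf u}_{\bar k},\tau_{\bar k})}|\big]$ if $i\in I_{c,j}^{e,\bar k}$ and $\max[|\underline\kappa_{p,ji}^{e,\bar k}|,|\overline\kappa_{p,ji}^{e,\bar k}|]$ otherwise. $\kappa_{p,j}^{m,K}$ has components $\max\big[|\partial\underline g_{p,j}/\partial u_i|_{({\bf x}_K,\tau_{k+1})}|,|\partial\overline g_{p,j}/\partial u_i|_{({\bf x}_K,\tau_{k+1})}|\big]$ if $i\in I_{c,j}^K$ and $\max[|\underline\kappa_{p,ji}^K|,|\overline\kappa_{p,ji}^K|]$ otherwise. Put $$A_j(\bar k)=\overline g_{p,j}({\bf u}_{\bar k},\tau_{\bar k})+\eta_{c,j}^{e,\bar k}\frac{\partial\overline g_{p,j}}{\partial\tau}\Big|_{({\bf u}_{\bar k},\tau_{\bar k})}(\tau_{k+1}-\tau_{\bar k})+(1-\eta_{c,j}^{e,\bar k})\overline\kappa_{p,j\tau}^{e,\bar k}(\tau_{k+1}-\tau_{\bar k})+\delta_e\|\kappa_{p,j}^{m,\bar k}\|_2 .$$ **Assumptions.** - A1F: $\phi_p$ (or $\phi$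 if the cost is numerical), all $g_{p,j}$ and all $g_j$ are $C^2$ on an open set containing $\mathcal I_\tau$ (numerical functions being functions of ${\bf u}$ only). - A2F: $g_{p,j}({\bf u},\tau)<0$ for all ${\bf u}\in\mathcal B_{e,0}$, all $\tau\in[\tau_0,\overline\tau]$ and all $j$; $g_j({\bf u})\le0$ for all ${\bf u}\in\mathcal B_{e,0}$ and all $j$; and ${\bf u}^L+\delta_e{\bf 1}\preceq{\bf u}_0\preceq{\bf u}^U-\delta_e{\bf 1}$. - A3: all supplied Lipschitz constants of the experimental constraints (global and local) are correct. - A4: the concavity indicators and index sets of the experimental constraints, $\eta_{c,j},\eta_{c,j}^{e,\bar k},\eta_{c,j}^{\bar k},\eta_{c,j}^K$ and $I_{c,j},I_{c,j}^{\bar k},I_{c,j}^{e,\bar k},I_{c,j}^K$, are correct, i.e. the concave relationships they denote exist on the relevant sets. - A5: $g_{p,j}({\bf u}_{\bar k},\tau_{\bar k})\le\overline g_{p,j}({\bf u}_{\bar k},\tau_{\bar k})$ almost surely for all $j$ and all $\bar k\in[0,k]$. - A6: $\nabla g_{p,j}({\bf u}_{\bar k},\tau_{\bar k})\in[\nabla\underline g_{p,j}({\bf u}_{\bar k},\tau_{\bar k}),\nabla\overline g_{p,j}({\bf u}_{\bar k},\tau_{\bar k})]$ (componentwise) almost surely for all $j$ and all $\bar k\in[0,k]$. **Reference problems** (over integers $\bar k\in[0,k]$). Let ${\bf k}_f$ be the set of $\bar k\in\{0,\dots,k\}$ with $A_j(\bar k)\le d_{p,j}^{k+1}$ for all $j=1,\dots,n_{g_p}$;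 $\max_{{\bf u}\in\mathcal B_{e,\bar k}}g_j({\bf u})\le d_j^{k+1}$ for all $j=1,\dots,n_g$; and ${\bf u}^L+\delta_e{\bf 1}\preceq{\bf u}_{\bar k}\preceq{\bf u}^U-\delta_e{\bf 1}$. - (Ref): $k^*$ maximizes $\bar k$ over $\bar k\in{\bf k}_f$ satisfying $$\underline\phi_p({\bf u}_{\bar k},\tau_{\bar k})+\eta_{v,\phi}^{\bar k,k}\tfrac{\partial\underline\phi_p}{\partial\tau}\big|_{({\bf u}_{\bar k},\tau_{\bar k})}(\tau_k-\tau_{\bar k})+(1-\eta_{v,\phi}^{\bar k,k})\underline\kappa_{\phi,\tau}^{\bar k,k}(\tau_k-\tau_{\bar k})\le\min_{\tilde k\in{\bf k}_f}\Big[\overline\phi_p({\bf u}_{\tilde k},\tau_{\tilde k})+\eta_{c,\phi}^{\tilde k,k}\tfrac{\partial\overline\phi_p}{\partial\tau}\big|_{({\bf u}_{\tilde k},\tau_{\tilde k})}(\tau_k-\tau_{\tilde k})+(1-\eta_{c,\phi}^{\tilde k,k})\overline\kappa_{\phi,\tau}^{\tilde k,k}(\tau_k-\tau_{\tilde k})\Big].$$ - (Ref-num): $k^*$ minimizes $\phi({\bf u}_{\bar k})$ over $\bar k\in{\bf k}_f$. **Algorithm 3F** (input: an arbitrary optimal target ${\bf u}_{k+1}^*$ from any optimization method; output $\bar{\bf u}_{k+1}^*$). Let $\mathcal A_p=\{j:A_j(k^* )\ge-\epsilon_{p,j}+d_{p,j}^{k+1}\}$ and $\mathcal A=\{j:\max_{{\bf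 u}\in\mathcal B_{e,k^*}}g_j({\bf u})\ge-\epsilon_j+d_j^{k+1}\}$. 1. Set $\epsilon_{p,j}:=\overline\epsilon_{p,j}$, $\epsilon_j:=\overline\epsilon_j$, $\delta_{g_p,j}:=\overline\delta_{g_p,j}$, $\delta_{g,j}:=\overline\delta_{g,j}$, $\delta_\phi:=\overline\delta_\phi$, given positive initial values (with $\overline\epsilon_{p,j}=\overline\delta_{g_p,j}\approx-\min_{\mathcal I_\tau}g_{p,j}$, $\overline\epsilon_j=\overline\delta_{g,j}\approx-\min_{\mathcal I}g_j$, $\overline\delta_\phi\approx\phi_p({\bf u}_0,\tau_0)-\min_{\mathcal I_\tau}\phi_p$); $\underline P:=0$, $\overline P:=1$. 2. Check feasibility (in ${\bf u}$) of: $\nabla\hat g_{p,j}({\bf u}_{k^*},\tau_{k+1})^T[{\bf u}-{\bf u}_{k^*};0]\le-\delta_{g_p,j}$ for $j\in\mathcal A_p$; $\nabla g_j({\bf u}_{k^*})^T({\bf u}-{\bf u}_{k^*})\le-\delta_{g,j}$ for $j\in\mathcal A$; $\nabla\hat\phi_p({\bf u}_{k^*},\tau_{k+1})^T[{\bf u}-{\bf u}_{k^*};0]\le-\delta_\phi$ (for a numerical cost, instead $\nabla\phi({\bf u}_{k^*})^T({\bf u}-{\bf u}_{k^*})\le-\delta_\phi$); ${\bf u}^L+\delta_e{\bf 1}\preceq{\bf u}\preceq{\bf u}^U-\delta_e{\bf 1}$. If infeasible and $\delta_\phi\ge\overline\delta_\phi/2^{10}$, halve all the parameters $\epsilon_{p,j},\epsilon_j,\delta_{g_p,j},\delta_{g,j},\delta_\phi$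 and repeat this step; otherwise go to 3. 3. If $\delta_\phi<\overline\delta_\phi/2^{10}$, terminate with $\bar{\bf u}_{k+1}^*:={\bf u}_{k^*}$. Otherwise set $P:=0.5\underline P+0.5\overline P$ and define tightened bounds $\nabla\underline\phi_p^t:=\nabla\hat\phi_p+P(\nabla\underline\phi_p-\nabla\hat\phi_p)$, $\nabla\overline\phi_p^t:=\nabla\hat\phi_p+P(\nabla\overline\phi_p-\nabla\hat\phi_p)$, and likewise $\nabla\underline g_{p,j}^t,\nabla\overline g_{p,j}^t$, all at $({\bf u}_{k^*},\tau_{k+1})$. 4. Check feasibility of the projection (Proj): minimize $\|{\bf u}-{\bf u}_{k+1}^*\|_2^2$ over ${\bf u},{\bf s}_\phi,{\bf S}$ subject to: for $j\in\mathcal A_p$, $\sum_is_{ji}\le-\delta_{g_p,j}$ and, for all $i$, $\frac{\partial\underline g_{p,j}^t}{\partial u_i}(u_i-u_{k^*,i})\le s_{ji}$, $\frac{\partial\overline g_{p,j}^t}{\partial u_i}(u_i-u_{k^*,i})\le s_{ji}$; for $j\in\mathcal A$, $\nabla g_j({\bf u}_{k^*})^T({\bf u}-{\bf u}_{k^*})\le-\delta_{g,j}$; $\sum_is_{\phi,i}\le-\delta_\phi$ and, for all $i$, $\frac{\partial\underline\phi_p^t}{\partial u_i}(u_i-u_{k^*,i})\le s_{\phi,i}$, $\frac{\partial\overline\phi_p^t}{\partial u_i}(u_i-u_{k^*,i})\le s_{\phi,i}$ (for a numerical cost, the last group and ${\bf s}_\phi$ are replaced by $\nabla\phi({\bf u}_{k^*})^T({\bf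 u}-{\bf u}_{k^*})\le-\delta_\phi$); ${\bf u}^L+\delta_e{\bf 1}\preceq{\bf u}\preceq{\bf u}^U-\delta_e{\bf 1}$. If infeasible set $\overline P:=P$, else $\underline P:=P$. If $\overline P-\underline P<0.01$ go to 5, else return to 3. 5. Set $P:=0.5\underline P$, define the tightened bounds with this $P$, and let $\bar{\bf u}_{k+1}^*$ be the ${\bf u}$-part of the solution of (Proj). Terminate. **Line searches.** For ${\bf x}={\bf x}_K$ let $$G_j(K)=\min_{\bar k=0,\dots,k}\Big[\overline g_{p,j}({\bf u}_{\bar k},\tau_{\bar k})+\eta_{c,j}^{\bar k}\tfrac{\partial\overline g_{p,j}}{\partial\tau}\big|_{({\bf u}_{\bar k},\tau_{\bar k})}(\tau_{k+1}-\tau_{\bar k})+(1-\eta_{c,j}^{\bar k})\overline\kappa_{p,j\tau}^{\bar k}(\tau_{k+1}-\tau_{\bar k})$$ $$+\sum_{i\in I_{c,j}^{\bar k}}\max\big[\tfrac{\partial\underline g_{p,j}}{\partial u_i}\big|_{({\bf u}_{\bar k},\tau_{\bar k})}(x_{K,i}-u_{\bar k,i}),\tfrac{\partial\overline g_{p,j}}{\partial u_i}\big|_{({\bf u}_{\bar k},\tau_{\bar k})}(x_{K,i}-u_{\bar k,i})\big]+\sum_{i\notin I_{c,j}^{\bar k}}\max\big[\underline\kappa_{p,ji}^{\bar k}(x_{K,i}-u_{\bar k,i}),\overline\kappa_{p,ji}^{\bar k}(x_{K,i}-u_{\bar k,i})\big]\Big].$$ Conditions on $K$: - (F1) $G_j(K)\le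 d_{p,j}^{k+1}$, $j=1,\dots,n_{g_p}$. - (F2) $G_j(K)+\eta_{c,j}^K\frac{\partial\overline g_{p,j}}{\partial\tau}|_{({\bf x}_K,\tau_{k+1})}(\tau_{k+2}-\tau_{k+1})+(1-\eta_{c,j}^K)\overline\kappa_{p,j\tau}^K(\tau_{k+2}-\tau_{k+1})+\delta_e\|\kappa_{p,j}^{m,K}\|_2\le d_{p,j}^{k+1}$, $j=1,\dots,n_{g_p}$. - (F2') $G_j(K)+\delta_e\|\kappa_{p,j}^{m,K}\|_2\le d_{p,j}^{k+1}$, $j=1,\dots,n_{g_p}$. - (F3) $\max_{{\bf u}\in\mathcal B_K}g_j({\bf u})\le d_j^{k+1}$, $j=1,\dots,n_g$. - (C1) with $\Delta_i=\bar u_{k+1,i}^*-u_{k^*,i}$ and tightened bounds at $({\bf u}_{k^*},\tau_{k+1})$ from Algorithm 3F: $\sum_i\max\big[\frac{\partial\underline\phi_p^t}{\partial u_i}\Delta_i,\frac{\partial\overline\phi_p^t}{\partial u_i}\Delta_i\big]+\frac K2\sum_{i_1}\sum_{i_2}\max\big[\underline M_{\phi,i_1i_2}^{k^*}\Delta_{i_1}\Delta_{i_2},\overline M_{\phi,i_1i_2}^{k^*}\Delta_{i_1}\Delta_{i_2}\big]\le0$. - (C2) $\max_{\bar k=0,\dots,k}\Big[\underline\phi_p({\bf u}_{\bar k},\tau_{\bar k})+\eta_{v,\phi}^{\bar k}\frac{\partial\underline\phi_p}{\partial\tau}|_{({\bf u}_{\bar k},\tau_{\bar k})}(\tau_{k+1}-\tau_{\bar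 k})+(1-\eta_{v,\phi}^{\bar k})\underline\kappa_{\phi,\tau}^{\bar k}(\tau_{k+1}-\tau_{\bar k})+\sum_{i\in I_{v,\phi}^{\bar k}}\min\big[\frac{\partial\underline\phi_p}{\partial u_i}|_{({\bf u}_{\bar k},\tau_{\bar k})}(x_{K,i}-u_{\bar k,i}),\frac{\partial\overline\phi_p}{\partial u_i}|_{({\bf u}_{\bar k},\tau_{\bar k})}(x_{K,i}-u_{\bar k,i})\big]+\sum_{i\notin I_{v,\phi}^{\bar k}}\min\big[\underline\kappa_{\phi,i}^{\bar k}(x_{K,i}-u_{\bar k,i}),\overline\kappa_{\phi,i}^{\bar k}(x_{K,i}-u_{\bar k,i})\big]\Big]\le\min_{\tilde k=0,\dots,k}\Big[\overline\phi_p({\bf u}_{\tilde k},\tau_{\tilde k})+\eta_{c,\phi}^{\tilde k}\frac{\partial\overline\phi_p}{\partial\tau}|_{({\bf u}_{\tilde k},\tau_{\tilde k})}(\tau_{k+1}-\tau_{\tilde k})+(1-\eta_{c,\phi}^{\tilde k})\overline\kappa_{\phi,\tau}^{\tilde k}(\tau_{k+1}-\tau_{\tilde k})+\sum_{i\in I_{c,\phi}^{\tilde k}}\max\big[\frac{\partial\underline\phi_p}{\partial u_i}|_{({\bf u}_{\tilde k},\tau_{\tilde k})}(u_{k^*,i}-u_{\tilde k,i}),\frac{\partial\overline\phi_p}{\partial u_i}|_{({\bf u}_{\tilde k},\tau_{\tilde k})}(u_{k^*,i}-u_{\tilde k,i})\big]+\sum_{i\notin I_{c,\phi}^{\tilde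 k}}\max\big[\underline\kappa_{\phi,i}^{\tilde k}(u_{k^*,i}-u_{\tilde k,i}),\overline\kappa_{\phi,i}^{\tilde k}(u_{k^*,i}-u_{\tilde k,i})\big]\Big]$. (LS1): maximize $K\in[0,1]$ subject to (F1),(F2),(F3),(C1),(C2). (LS2): maximize $K\in[0,1]$ subject to (F2'),(F3),(C1),(C2). (LS1-num): minimize $\phi({\bf x}_K)$ over $K\in[0,1]$ subject to (F1),(F2),(F3). (LS2-num): minimize $\phi({\bf x}_K)$ over $K\in[0,1]$ subject to (F2'),(F3). *)

(* Defs.v *)
From HB Require Import structures.
From mathcomp Require Export all_boot all_order all_algebra.
From mathcomp Require Export all_classical all_reals all_analysis.
Export Order.TTheory GRing.Theory Num.Theory.
Export numFieldNormedType.Exports.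

Set Implicit Arguments.
Unset Strict Implicit.
Unset Printing Implicit Defensive.

Local Open Scope classical_set_scope.
Local Open Scope ring_scope.

(* Points (u, tau), and gradients with respect to (u, tau), are pairs in    *)
(* 'rV[R]_n * R.                                                            *)

Definition dot {R : realType} {n : nat} (a b : 'rV[R]_n) : R :=
  \sum_i a 0 i * b 0 i.

Definition dotT {R : realType} {n : nat} (a b : 'rV[R]_n * R) : R :=
  dot a.1 b.1 + a.2 * b.2.

(* Euclidean norm; the library norm on 'rV[R]_n is the sup norm. *)
Definition norm2 {R : realType} {n : nat} (a : 'rV[R]_n) : R :=
  Num.sqrt (\sum_i a 0 i ^+ 2).

Definition vle {R : realType} {n : nat} (a b : 'rV[R]_n) : Prop :=
  forall i, a 0 i <= b 0 i.

Definition box {R : realType} {n : nat} (a b : 'rV[R]_n) : set 'rV[R]_n :=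
  [set u | vle a u /\ vle u b].

Definition bbox {R : realType} {n : nat} (A : set 'rV[R]_n) : set 'rV[R]_n :=
  smallest (fun B => exists a b, B = box a b) A.

Definition eball {R : realType} {n : nat} (c : 'rV[R]_n) (r : R) :
    set 'rV[R]_n := [set u | norm2 (u - c) <= r].

Definition timeint {R : realType} (a b : R) : set R := [set t | a <= t <= b].

Definition gradV {R : realType} {n : nat} (f : 'rV[R]_n -> R) (u : 'rV[R]_n) :
    'rV[R]_n := \row_i 'D_(delta_mx 0 i) f u.

Definition gradT {R : realType} {n : nat} (f : 'rV[R]_n * R -> R)
    (p : 'rV[R]_n * R) : 'rV[R]_n * R :=
  (\row_i 'D_((delta_mx 0 i, 0) : 'rV[R]_n * R) f p,
   'D_((0, 1) : 'rV[R]_n * R) f p).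

(* f is twice continuously differentiable on O; this is the usual notion    *)
(* when V is finite dimensional, the only case in which it is used.         *)
Definition C2_on {R : realType} {V : normedModType R} (O : set V)
    (f : V -> R) : Prop :=
  [/\ forall x, O x -> differentiable f x,
      forall (v x : V), O x -> differentiable ('D_v f) x &
      forall (v w x : V), O x -> {for x, continuous ('D_w ('D_v f))}].

Definition C2_near {R : realType} {V : normedModType R} (S : set V)
    (f : V -> R) : Prop :=
  exists O : set V, [/\ open O, S `<=` O & C2_on O f].

(* An index set of the subvector z of u, and whether concavity (convexity)  *)
(* is joint in (z, tau).                                                    *)
Record shape (n : nat) := Shape { zset : {set 'I_n}; joint : bool }.

(* The points of S agreeing with p outside the coordinates z, and, unless   *)
(* with_tau, also agreeing with p in the time coordinate.                   *)
Definition slice {R : realType} {n : nat} (z : {set 'I_n}) (with_tau : bool)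
    (S : set ('rV[R]_n * R)) (p : 'rV[R]_n * R) : set ('rV[R]_n * R) :=
  [set q | [/\ S q, forall i, i \notin z -> q.1 0 i = p.1 0 i &
               with_tau \/ q.2 = p.2]].

Definition concave_in {R : realType} {n : nat} (z : {set 'I_n})
    (with_tau : bool) (S : set ('rV[R]_n * R)) (f : 'rV[R]_n * R -> R) : Prop :=
  forall p, S p ->
    @convex_function R ('rV[R]_n * R)%type (slice z with_tau S p)
      (fun q => - f q).

(* Only a claimed joint concavity is asserted: joint s = false says nothing. *)
Definition shape_correct {R : realType} {n : nat} (s : shape n)
    (S : set ('rV[R]_n * R)) (f : 'rV[R]_n * R -> R) : Prop :=
  concave_in (zset s) false S f /\
  (joint s -> concave_in (zset s) true S f).

Record lips (R : realType) (n : nat) := Lips {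
  lo_u : 'I_n -> R;  up_u : 'I_n -> R;
  lo_t : R;          up_t : R }.

Definition lips_bound {R : realType} {n : nat} (l : lips R n)
    (S : set ('rV[R]_n * R)) (f : 'rV[R]_n * R -> R) : Prop :=
  forall p, S p ->
    (forall i, lo_u l i < (gradT f p).1 0 i < up_u l i) /\
    lo_t l <= (gradT f p).2 <= up_t l.

Definition lips_refine {R : realType} {n : nat} (l lglob : lips R n) : Prop :=
  (forall i, lo_u lglob i <= lo_u l i /\ up_u l i <= up_u lglob i) /\
  (lo_t lglob <= lo_t l /\ up_t l <= up_t lglob).

Record gradest (R : realType) (n : nat) := GradEst {
  g_hat : 'rV[R]_n * R -> 'rV[R]_n * R;
  g_lo  : 'rV[R]_n * R -> 'rV[R]_n * R;
  g_up  : 'rV[R]_n * R -> 'rV[R]_n * R }.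

Definition drift {R : realType} (eta : bool) (a c dt : R) : R :=
  eta%:R * a * dt + (1 - eta%:R) * c * dt.

(* Bound at (x, t) propagated from the value v at p = (u_kbar, tau_kbar). *)
Definition upper_est {R : realType} {n : nat} (v : R) (q : gradest R n)
    (s : shape n) (l : lips R n) (p : 'rV[R]_n * R) (x : 'rV[R]_n) (t : R) :
    R :=
  v + drift (joint s) (g_up q p).2 (up_t l) (t - p.2)
  + \sum_(i in zset s)
      Num.max ((g_lo q p).1 0 i * (x 0 i - p.1 0 i))
              ((g_up q p).1 0 i * (x 0 i - p.1 0 i))
  + \sum_(i | i \notin zset s)
      Num.max (lo_u l i * (x 0 i - p.1 0 i)) (up_u l i * (x 0 i - p.1 0 i)).

Definition lower_est {R : realType} {n : nat} (v : R) (q : gradest R n)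
    (s : shape n) (l : lips R n) (p : 'rV[R]_n * R) (x : 'rV[R]_n) (t : R) :
    R :=
  v + drift (joint s) (g_lo q p).2 (lo_t l) (t - p.2)
  + \sum_(i in zset s)
      Num.min ((g_lo q p).1 0 i * (x 0 i - p.1 0 i))
              ((g_up q p).1 0 i * (x 0 i - p.1 0 i))
  + \sum_(i | i \notin zset s)
      Num.min (lo_u l i * (x 0 i - p.1 0 i)) (up_u l i * (x 0 i - p.1 0 i)).

Definition backoff {R : realType} {n : nat} (q : gradest R n)
    (s : shape n) (l : lips R n) (p : 'rV[R]_n * R) : 'rV[R]_n :=
  \row_i if i \in zset s
         then Num.max `|(g_lo q p).1 0 i| `|(g_up q p).1 0 i|
         else Num.max `|lo_u l i| `|up_u l i|.

Definition tighten {R : realType} {n : nat} (P : R)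
    (ghat gbound : 'rV[R]_n * R) : 'rV[R]_n * R :=
  ghat + P *: (gbound - ghat).

(* A problem holds the deterministic data; a run is one realization of the  *)
(* whole sequence of iterations.                                            *)

Inductive cost (R : realType) (n : nat) :=
| Experimental of ('rV[R]_n * R -> R)
| Numerical of ('rV[R]_n -> R).

Record params (R : realType) (ngp ng : nat) := Params {
  eps_p : 'I_ngp -> R;    eps : 'I_ng -> R;
  delta_gp : 'I_ngp -> R; delta_g : 'I_ng -> R;
  delta_phi : R }.

Record problem (R : realType) (nu ngp ng : nat) := Problem {
  the_cost : cost R nu;
  gp : 'I_ngp -> 'rV[R]_nu * R -> R;
  g : 'I_ng -> 'rV[R]_nu -> R;
  uL : 'rV[R]_nu;         uU : 'rV[R]_nu;
  tau0 : R;               taubar : R;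
  delta_e : R;
  dbar_p : 'I_ngp -> R;   dbar : 'I_ng -> R;
  beta_p : 'I_ngp -> R;   beta : 'I_ng -> R;
  dS_p : 'I_ngp -> R;     dS : 'I_ng -> R;
  params0 : params R ngp ng;
  lips_glob : 'I_ngp -> lips R nu;
  shape_glob : 'I_ngp -> shape nu }.

(* In every field the first index k is the iteration at which the quantity  *)
(* is computed; estimates may be revised from one iteration to the next.    *)
(* Fields with two indices k kb refer to the past point kb <= k.  As an     *)
(* exception, fields with suffix _pair are indexed by kb1 <= kb2, the end   *)
(* points of the data they are associated with.                             *)
Record run (R : realType) (nu ngp ng : nat) := Run {
  u : nat -> 'rV[R]_nu;
  tau : nat -> R;
  (* ustar k and ubar k are the target u^*_{k+1} and its modification.      *)
  ustar : nat -> 'rV[R]_nu;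
  kref : nat -> nat;
  ubar : nat -> 'rV[R]_nu;
  Pfin : nat -> R;
  Kls : nat -> R;
  exciting : nat -> 'rV[R]_nu -> Prop;
  gp_up : nat -> 'I_ngp -> 'rV[R]_nu * R -> R;
  gp_grad : nat -> 'I_ngp -> gradest R nu;
  phi_lo : nat -> 'rV[R]_nu * R -> R;
  phi_up : nat -> 'rV[R]_nu * R -> R;
  phi_grad : nat -> gradest R nu;
  lips_loc : nat -> nat -> 'I_ngp -> lips R nu;
  lips_pair : nat -> nat -> 'I_ngp -> lips R nu;
  lips_e : nat -> nat -> 'I_ngp -> lips R nu;
  lips_K : nat -> R -> 'I_ngp -> lips R nu;
  shape_loc : nat -> nat -> 'I_ngp -> shape nu;
  shape_e : nat -> nat -> 'I_ngp -> shape nu;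
  shape_K : nat -> R -> 'I_ngp -> shape nu;
  phi_lips_loc : nat -> nat -> lips R nu;
  phi_lips_pair : nat -> nat -> lips R nu;
  hess_lo : nat -> nat -> 'I_nu -> 'I_nu -> R;
  hess_up : nat -> nat -> 'I_nu -> 'I_nu -> R;
  phi_ccv_loc : nat -> nat -> shape nu;
  phi_cvx_loc : nat -> nat -> shape nu;
  phi_ccv_pair : nat -> nat -> shape nu;
  phi_cvx_pair : nat -> nat -> shape nu }.

Section Scheme.
Context {R : realType} {nu ngp ng : nat}.
Implicit Types (p : problem R nu ngp ng) (r : run R nu ngp ng).
Implicit Types (k kb : nat) (K P : R) (s : params R ngp ng).

Definition Ibox p : set 'rV[R]_nu := box (uL p) (uU p).

Definition Itau p : set ('rV[R]_nu * R) :=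
  Ibox p `*` timeint (tau0 p) (taubar p).

Definition shrunk_box p : set 'rV[R]_nu :=
  box (uL p + const_mx (delta_e p)) (uU p - const_mx (delta_e p)).

Definition constants_ok p : Prop :=
  [/\ 0 < delta_e p,
      forall j, [/\ 0 <= dbar_p p j, 0 <= beta_p p j < 1 & 0 < dS_p p j],
      forall j, [/\ 0 <= dbar p j, 0 <= beta p j < 1 & 0 < dS p j],
      [/\ forall j, 0 < eps_p (params0 p) j,
          forall j, 0 < eps (params0 p) j,
          forall j, eps_p (params0 p) j = delta_gp (params0 p) j &
          forall j, eps (params0 p) j = delta_g (params0 p) j] &
      0 < delta_phi (params0 p)].

Definition times_ok p r : Prop :=
  [/\ tau r 0 = tau0 p, forall k, tau r k <= tau r k.+1 &
      forall k, tau r k <= taubar p].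

Definition pt r kb : 'rV[R]_nu * R := (u r kb, tau r kb).

Definition xK r k K : 'rV[R]_nu :=
  u r (kref r k) + K *: (ubar r k - u r (kref r k)).

Definition Be p r kb : set 'rV[R]_nu := eball (u r kb) (delta_e p).
Definition BK p r k K : set 'rV[R]_nu := eball (xK r k K) (delta_e p).

Definition set_loc r k kb : set ('rV[R]_nu * R) :=
  bbox [set u r kb; u r (kref r k); ubar r k] `*`
  timeint (Num.min (tau r kb) (tau r (kref r k))) (tau r k.+1).

Definition set_pair r kb1 kb2 : set ('rV[R]_nu * R) :=
  bbox [set u r kb1; u r kb2] `*` timeint (tau r kb1) (tau r kb2).

Definition set_e p r k kb : set ('rV[R]_nu * R) :=
  Be p r kb `*` timeint (tau r kb) (tau r k.+1).

Definition set_K p r k K : set ('rV[R]_nu * R) :=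
  BK p r k K `*` timeint (tau r k.+1) (tau r k.+2).

Definition A1F p : Prop :=
  [/\ match the_cost p with
      | Experimental phip => C2_near (Itau p) phip
      | Numerical phi => C2_near (Ibox p) phi
      end,
      forall j, C2_near (Itau p) (gp p j) &
      forall j, C2_near (Ibox p) (g p j)].

Definition A2F p r : Prop :=
  [/\ forall v t j, Be p r 0 v -> tau0 p <= t <= taubar p -> gp p j (v, t) < 0,
      forall v j, Be p r 0 v -> g p j v <= 0 &
      shrunk_box p (u r 0)].

Definition A3 p r : Prop :=
  forall j,
  [/\ lips_bound (lips_glob p j) (Itau p) (gp p j),
      forall k kb, (kb <= k)%N ->
        lips_bound (lips_loc r k kb j) (set_loc r k kb) (gp p j) /\
        lips_refine (lips_loc r k kb j) (lips_glob p j),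
      forall kb1 kb2, (kb1 <= kb2)%N ->
        lips_bound (lips_pair r kb1 kb2 j) (set_pair r kb1 kb2) (gp p j) /\
        lips_refine (lips_pair r kb1 kb2 j) (lips_glob p j),
      forall k kb, (kb <= k)%N ->
        lips_bound (lips_e r k kb j) (set_e p r k kb) (gp p j) /\
        lips_refine (lips_e r k kb j) (lips_glob p j) &
      forall k K, 0 <= K <= 1 ->
        lips_bound (lips_K r k K j) (set_K p r k K) (gp p j) /\
        lips_refine (lips_K r k K j) (lips_glob p j)].

Definition A4 p r : Prop :=
  forall j,
  [/\ shape_correct (shape_glob p j) (Itau p) (gp p j),
      forall k kb, (kb <= k)%N ->
        shape_correct (shape_loc r k kb j) (set_loc r k kb) (gp p j),
      forall k kb, (kb <= k)%N ->
        shape_correct (shape_e r k kb j) (set_e p r k kb) (gp p j) &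
      forall k K, 0 <= K <= 1 ->
        shape_correct (shape_K r k K j) (set_K p r k K) (gp p j)].

Fixpoint slack_p p r k (j : 'I_ngp) : R :=
  if k is k'.+1 then
    if 0 < gp_up r k' j (pt r k') then beta_p p j * slack_p p r k' j
    else slack_p p r k' j
  else dbar_p p j.

Fixpoint slack p r k (j : 'I_ng) : R :=
  if k is k'.+1 then
    if 0 < g p j (u r k') then beta p j * slack p r k' j
    else slack p r k' j
  else dbar p j.

(* Maxima over balls are taken in \bar R, so that they make sense without   *)
(* any attainment hypothesis; under A1F they are genuine maxima.            *)
Definition gmax p (B : set 'rV[R]_nu) (j : 'I_ng) : \bar R :=
  ereal_sup [set (g p j v)%:E | v in B].

Definition Aval p r k (j : 'I_ngp) kb : R :=
  gp_up r k j (pt r kb)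
  + drift (joint (shape_e r k kb j)) (g_up (gp_grad r k j) (pt r kb)).2
      (up_t (lips_e r k kb j)) (tau r k.+1 - tau r kb)
  + delta_e p * norm2 (backoff (gp_grad r k j) (shape_e r k kb j)
                         (lips_e r k kb j) (pt r kb)).

Definition kf p r k : set nat :=
  [set kb | [/\ (kb <= k)%N,
    forall j, Aval p r k j kb <= slack_p p r k.+1 j,
    forall j, (gmax p (Be p r kb) j <= (slack p r k.+1 j)%:E)%E &
    shrunk_box p (u r kb)]].

Definition ref_lhs r k kb : R :=
  phi_lo r k (pt r kb)
  + drift (joint (phi_cvx_pair r kb k)) (g_lo (phi_grad r k) (pt r kb)).2
      (lo_t (phi_lips_pair r kb k)) (tau r k - tau r kb).

Definition ref_rhs r k kb : R :=
  phi_up r k (pt r kb)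
  + drift (joint (phi_ccv_pair r kb k)) (g_up (phi_grad r k) (pt r kb)).2
      (up_t (phi_lips_pair r kb k)) (tau r k - tau r kb).

Definition ref_feas p r k : set nat :=
  match the_cost p with
  | Experimental _ =>
      [set kb | kf p r k kb /\
        ((ref_lhs r k kb)%:E <=
           ereal_inf [set (ref_rhs r k kt)%:E | kt in kf p r k])%E]
  | Numerical _ => kf p r k
  end.

Definition ref_sol p r k kb : Prop :=
  ref_feas p r k kb /\
  match the_cost p with
  | Experimental _ => forall kt, ref_feas p r k kt -> (kt <= kb)%N
  | Numerical phi => forall kt, ref_feas p r k kt -> phi (u r kb) <= phi (u r kt)
  end.

Definition reference_rule p r k : Prop :=
  ref_sol p r k (kref r k) \/ (ref_feas p r k = set0 /\ kref r k = 0%N).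

Definition halve s : params R ngp ng :=
  Params (fun j => eps_p s j / 2) (fun j => eps s j / 2)
         (fun j => delta_gp s j / 2) (fun j => delta_g s j / 2)
         (delta_phi s / 2).

Definition active_p p r k s (j : 'I_ngp) : Prop :=
  - eps_p s j + slack_p p r k.+1 j <= Aval p r k j (kref r k).

Definition active p r k s (j : 'I_ng) : Prop :=
  ((- eps s j + slack p r k.+1 j)%:E <= gmax p (Be p r (kref r k)) j)%E.

Definition refpt r k : 'rV[R]_nu * R := (u r (kref r k), tau r k.+1).

Definition descent_feas p r k s : Prop :=
  exists v : 'rV[R]_nu, let dv := v - u r (kref r k) in
  [/\ forall j, active_p p r k s j ->
        dotT (g_hat (gp_grad r k j) (refpt r k)) (dv, 0) <= - delta_gp s j,
      forall j, active p r k s j ->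
        dot (gradV (g p j) (u r (kref r k))) dv <= - delta_g s j,
      match the_cost p with
      | Experimental _ =>
          dotT (g_hat (phi_grad r k) (refpt r k)) (dv, 0) <= - delta_phi s
      | Numerical phi =>
          dot (gradV phi (u r (kref r k))) dv <= - delta_phi s
      end &
      shrunk_box p v].

Definition exhausted p s : Prop :=
  delta_phi s < delta_phi (params0 p) / 2 ^+ 10.

Inductive halving p r k : params R ngp ng -> params R ngp ng -> Prop :=
| Halving_loop s s' : ~ descent_feas p r k s -> ~ exhausted p s ->
    halving p r k (halve s) s' -> halving p r k s s'
| Halving_exit s : descent_feas p r k s \/ exhausted p s ->
    halving p r k s s.

Definition tlo (q : gradest R nu) (x : 'rV[R]_nu * R) P : 'rV[R]_nu :=
  (tighten P (g_hat q x) (g_lo q x)).1.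
Definition tup (q : gradest R nu) (x : 'rV[R]_nu * R) P : 'rV[R]_nu :=
  (tighten P (g_hat q x) (g_up q x)).1.

(* For a numerical cost the slack vector sphi is a dummy. *)
Definition proj_feas p r k s P (v sphi : 'rV[R]_nu) (S : 'M[R]_(ngp, nu)) :
    Prop :=
  let dv := v - u r (kref r k) in
  [/\ forall j, active_p p r k s j ->
        \sum_i S j i <= - delta_gp s j /\
        forall i, tlo (gp_grad r k j) (refpt r k) P 0 i * dv 0 i <= S j i /\
                  tup (gp_grad r k j) (refpt r k) P 0 i * dv 0 i <= S j i,
      forall j, active p r k s j ->
        dot (gradV (g p j) (u r (kref r k))) dv <= - delta_g s j,
      match the_cost p with
      | Experimental _ =>
          \sum_i sphi 0 i <= - delta_phi s /\
          forall i, tlo (phi_grad r k) (refpt r k) P 0 i * dv 0 i <= sphi 0 i /\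
                    tup (phi_grad r k) (refpt r k) P 0 i * dv 0 i <= sphi 0 i
      | Numerical phi =>
          dot (gradV phi (u r (kref r k))) dv <= - delta_phi s
      end &
      shrunk_box p v].

Definition proj_feasible p r k s P : Prop :=
  exists v sphi S, proj_feas p r k s P v sphi S.

Definition proj_sol p r k s P (v : 'rV[R]_nu) : Prop :=
  exists sphi S, proj_feas p r k s P v sphi S /\
    forall v' sphi' S', proj_feas p r k s P v' sphi' S' ->
      norm2 (v - ustar r k) ^+ 2 <= norm2 (v' - ustar r k) ^+ 2.

Definition bisect (F : R -> Prop) (I : R * R) : R * R :=
  let P := I.1 / 2 + I.2 / 2 in
  if `[< F P >] then (P, I.2) else (I.1, P).

Inductive bisection (F : R -> Prop) : R * R -> R -> Prop :=
| Bisection_loop I Pl : ~ ((bisect F I).2 - (bisect F I).1 < 1 / 100) ->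
    bisection F (bisect F I) Pl -> bisection F I Pl
| Bisection_exit I : (bisect F I).2 - (bisect F I).1 < 1 / 100 ->
    bisection F I (bisect F I).1.

(* ubar r k is an output of the algorithm and Pfin r k the factor P with    *)
(* which the tightened bounds are finally defined.  On early termination    *)
(* ubar r k = u_{k^*}, and Pfin r k plays no role: it enters (C1) only      *)
(* through terms multiplied by components of ubar r k - u_{k^*}.            *)
Definition algorithm3F p r k : Prop :=
  exists s, halving p r k (params0 p) s /\
    ((exhausted p s /\ ubar r k = u r (kref r k)) \/
     (~ exhausted p s /\
      exists Pl, [/\ bisection (proj_feasible p r k s) (0, 1) Pl,
                     Pfin r k = Pl / 2 & proj_sol p r k s (Pfin r k) (ubar r k)])).

Definition Gval r k (j : 'I_ngp) K : R :=
  let F kb := upper_est (gp_up r k j (pt r kb)) (gp_grad r k j)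
                (shape_loc r k kb j) (lips_loc r k kb j) (pt r kb)
                (xK r k K) (tau r k.+1) in
  \big[Num.min/F 0%N]_(kb < k.+1) F kb.

Definition backoff_K r k (j : 'I_ngp) K : 'rV[R]_nu :=
  backoff (gp_grad r k j) (shape_K r k K j) (lips_K r k K j)
    (xK r k K, tau r k.+1).

Definition F1 p r k K : Prop :=
  forall j, Gval r k j K <= slack_p p r k.+1 j.

Definition F2 p r k K : Prop :=
  forall j, Gval r k j K
    + drift (joint (shape_K r k K j))
        (g_up (gp_grad r k j) (xK r k K, tau r k.+1)).2
        (up_t (lips_K r k K j)) (tau r k.+2 - tau r k.+1)
    + delta_e p * norm2 (backoff_K r k j K) <= slack_p p r k.+1 j.

Definition F2' p r k K : Prop :=
  forall j, Gval r k j K + delta_e p * norm2 (backoff_K r k j K)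
            <= slack_p p r k.+1 j.

Definition F3 p r k K : Prop :=
  forall j, (gmax p (BK p r k K) j <= (slack p r k.+1 j)%:E)%E.

Definition C1 r k K : Prop :=
  let D := ubar r k - u r (kref r k) in
  let lo := tlo (phi_grad r k) (refpt r k) (Pfin r k) in
  let up := tup (phi_grad r k) (refpt r k) (Pfin r k) in
  \sum_i Num.max (lo 0 i * D 0 i) (up 0 i * D 0 i)
  + K / 2 * \sum_i1 \sum_i2
      Num.max (hess_lo r k (kref r k) i1 i2 * D 0 i1 * D 0 i2)
              (hess_up r k (kref r k) i1 i2 * D 0 i1 * D 0 i2) <= 0.

Definition C2 r k K : Prop :=
  let L kb := lower_est (phi_lo r k (pt r kb)) (phi_grad r k)
                (phi_cvx_loc r k kb) (phi_lips_loc r k kb) (pt r kb)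
                (xK r k K) (tau r k.+1) in
  let U kb := upper_est (phi_up r k (pt r kb)) (phi_grad r k)
                (phi_ccv_loc r k kb) (phi_lips_loc r k kb) (pt r kb)
                (u r (kref r k)) (tau r k.+1) in
  \big[Num.max/L 0%N]_(kb < k.+1) L kb <= \big[Num.min/U 0%N]_(kt < k.+1) U kt.

Definition cost_conditions p r k K : Prop :=
  match the_cost p with
  | Experimental _ => C1 r k K /\ C2 r k K
  | Numerical _ => True
  end.

Definition ls1_feas p r k : set R :=
  [set K | 0 <= K <= 1 /\
     [/\ F1 p r k K, F2 p r k K, F3 p r k K & cost_conditions p r k K]].

Definition ls2_feas p r k : set R :=
  [set K | 0 <= K <= 1 /\
     [/\ F2' p r k K, F3 p r k K & cost_conditions p r k K]].

Definition ls_sol p r k (F : set R) K : Prop :=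
  F K /\
  match the_cost p with
  | Experimental _ => forall K', F K' -> K' <= K
  | Numerical phi => forall K', F K' -> phi (xK r k K) <= phi (xK r k K')
  end.

(* A feasible line search is assumed to have a solution: the three cases    *)
(* below are the only possible outcomes.                                    *)
Definition step_rule p r k : Prop :=
  [\/ ls_sol p r k (ls1_feas p r k) (Kls r k),
      ls1_feas p r k = set0 /\ ls_sol p r k (ls2_feas p r k) (Kls r k) |
      [/\ ls1_feas p r k = set0, ls2_feas p r k = set0 & Kls r k = 0]].

Definition update_rule p r k : Prop :=
  let cand := xK r k (Kls r k) in
  (exciting r k cand -> u r k.+1 = cand) /\
  (~ exciting r k cand -> Be p r (kref r k) (u r k.+1)).

End Scheme.

(* The realizations X w are indexed by the points w of a probability space. *)
(* No measurability of X is required: {ae Pr, Q} says that the complement   *)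
(* of Q is contained in a measurable null set.                              *)

Definition A5 {R : realType} {nu ngp ng : nat} {d : measure_display}
    {Omega : measurableType d} (Pr : probability Omega R)
    (p : problem R nu ngp ng) (X : Omega -> run R nu ngp ng) : Prop :=
  forall (j : 'I_ngp) (k kb : nat), (kb <= k)%N ->
    {ae Pr, forall w, gp p j (pt (X w) kb) <= gp_up (X w) k j (pt (X w) kb)}.

Definition A6 {R : realType} {nu ngp ng : nat} {d : measure_display}
    {Omega : measurableType d} (Pr : probability Omega R)
    (p : problem R nu ngp ng) (X : Omega -> run R nu ngp ng) : Prop :=
  forall (j : 'I_ngp) (k kb : nat), (kb <= k)%N ->
    {ae Pr, forall w,
      let x := pt (X w) kb in
      let q := gp_grad (X w) k j in
      (forall i, (g_lo q x).1 0 i <= (gradT (gp p j) x).1 0 i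
                                  <= (g_up q x).1 0 i) /\
      (g_lo q x).2 <= (gradT (gp p j) x).2 <= (g_up q x).2}.

(* Main.v *)
(* Each new input either comes out of a line search, where G_j(K) <= d^{k+1},
   or lies in the ball of radius delta_e about the reference input, where
   A_j(k^* ) <= d^{k+1} (or, at u_0, where the constraints are satisfied). Since
   G_j(K) and A_j(k^* ) bound the constraint from above, a violation at
   iteration k never exceeds the slack d^k; and a violation shrinks the slack
   by the factor beta, so (1 - beta) times it is at most d^k - d^{k+1}.
   Telescoping bounds the total violation by d^0 / (1 - beta) <= d^S. The
   back-off terms of the line searches, which use estimates at x_K, enter only
   through their sign. *)
Require Import Defs.
From mathcomp Require Import ring lra.

Set Implicit Arguments.
Unset Strict Implicit.
Unset Printing Implicit Defensive.

Local Open Scope classical_set_scope.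
Local Open Scope ring_scope.

(** * Directional derivatives, mean values and tangent inequalities *)

Lemma derive_dotT {R : realType} {n : nat} (f : 'rV[R]_n * R -> R)
    (a v : 'rV[R]_n * R) :
  differentiable f a -> 'D_v f a = dotT (gradT f a) v.
Proof.
move=> df.
have vE : v = \sum_i v.1 0 i *: ((delta_mx 0 i, 0) : 'rV[R]_n * R)
              + v.2 *: ((0, 1) : 'rV[R]_n * R).
  have sum_pair (F : 'I_n -> 'rV[R]_n * R) :
      \sum_i F i = (\sum_i (F i).1, \sum_i (F i).2).
    by elim/big_rec3: _ => // i x y [z t] _ [-> ->].
  rewrite sum_pair; case: v => v t; congr (_, _) => /=.
    rewrite scaler0 addr0 [LHS]row_sum_delta.
    by apply: eq_bigr => i _.
  rewrite big1 ?add0r => [|i _]; last by rewrite scaler0.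
  by rewrite /GRing.scale/= mulr1.
rewrite deriveE// {1}vE linearD linear_sum linearZ/=.
rewrite /dotT /dot /gradT/=; congr (_ + _); last by rewrite deriveE// mulrC.
by apply: eq_bigr => i _; rewrite mxE deriveE// linearZ/= mulrC.
Qed.

(** One-dimensional mean value theorem for the restriction [h] of f to the segment.
    Differentiability in [V] at the end points makes [h] differentiable there too, hence continuous
    on the closed interval. *)
Lemma mean_value_segment {R : realType} {V : normedModType R} (f : V -> R)
    (a v : V) :
  (forall s : R, 0 <= s <= 1 -> differentiable f (a + s *: v)) ->
  exists2 s : R, 0 <= s <= 1 & f (a + v) - f a = 'D_v f (a + s *: v).
Proof.
move=> df; pose h (s : R) := f (a + s *: v).
have hd (s : R) : 0 <= s <= 1 -> is_derive s 1 h ('D_v f (a + s *: v)).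
  move=> s01.
  have dfs : is_diff (a + s *: v) f ('d f (a + s *: v)).
    by apply: DiffDef; first exact: df.
  have dl : is_diff s (fun t : R => a + t *: v) (fun t => t *: v).
    apply: is_diff_eq; apply: add0r.
  have := is_diff_comp dl dfs => -[dh hE].
  apply: DeriveDef; first exact/derivable1_diffP.
  by rewrite deriveE// hE/= scale1r deriveE//; apply: df.
have [s s01 hs] : exists2 s, s \in `[0, 1]%R &
    h 1 - h 0 = 'D_v f (a + s *: v) * (1 - 0).
  apply: MVT_segment => //.
    by move=> s; rewrite in_itv/= => /andP[s0 s1]; apply: hd; rewrite !ltW.
  by apply: derivable_within_continuous => s; rewrite in_itv/= => /hd[].
exists s => //.
by move: hs; rewrite /h scale1r scale0r addr0 subr0 mulr1.
Qed.

Lemma convex_tangent {R : realType} {V : normedModType R} (D : set V)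
    (f : V -> R) (a b : V) :
  @convex_function R V D f -> D a -> D b -> derivable f a (b - a) ->
  'D_(b - a) f a <= f b - f a.
Proof.
move=> cf Da Db df.
(* Convexity bounds the difference quotient by f b - f a only for steps s in (0, 1], so the limit is
   taken from the right. *)
rewrite /derive cvg_at_rightE//; apply: limr_le.
  by apply/cvg_ex; exists ('D_(b - a) f a); exact: cvg_dnbhs_at_right.
near=> s.
have s0 : 0 < s by [].
have s1 : s <= 1 by near: s; apply: nbhs_right_le.
have fs : f (s *: (b - a) + a) <= s * f b + (1 - s) * f a.
  have -> : s *: (b - a) + a = s *: b + (1 - s) *: a.
    by rewrite scalerBr scalerBl scale1r addrA addrAC.
  exact: (cf (Itv01 (ltW s0) s1) b a (mem_set Db) (mem_set Da)).
rewrite -[leLHS]/(s^-1 * _) ler_pdivrMl//=.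
lra.
Unshelve. all: by end_near.
Qed.

(** * Upper estimates from concavity and Lipschitz constants *)

Definition grad_bracket {R : realType} {n : nat} (q : gradest R n)
    (f : 'rV[R]_n * R -> R) (x : 'rV[R]_n * R) : Prop :=
  (forall i, (g_lo q x).1 0 i <= (gradT f x).1 0 i <= (g_up q x).1 0 i) /\
  (g_lo q x).2 <= (gradT f x).2 <= (g_up q x).2.

(** With z the concave coordinates, x the target and y the start, this is the turning point of the
    two-leg path used in [le_upper_est]. *)
Definition mixv {R : realType} {n : nat} (z : {set 'I_n}) (x y : 'rV[R]_n) :
    'rV[R]_n := \row_i if i \in z then x 0 i else y 0 i.

Lemma ler_mul_max {R : realDomainType} (lo a up d : R) :
  lo <= a <= up -> a * d <= Num.max (lo * d) (up * d).
Proof.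
move=> /andP[loa aup]; rewrite le_max.
have [d0|/ltW d0] := leP 0 d; first by rewrite (ler_wpM2r d0 aup) orbT.
by rewrite (ler_wnM2r d0 loa).
Qed.

(** Serves both legs: [P] selects the coordinates that move, [lo] and [up] are gradient bounds on
    the first leg and Lipschitz constants on the second, and [c] bounds the time term. *)
Lemma dotT_le_max {R : realType} {n : nat} (P : pred 'I_n)
    (G d : 'rV[R]_n * R) (lo up : 'I_n -> R) (c : R) :
  (forall i, ~~ P i -> d.1 0 i = 0) ->
  (forall i, P i -> lo i <= G.1 0 i <= up i) ->
  G.2 * d.2 <= c ->
  dotT G d <= \sum_(i | P i) Num.max (lo i * d.1 0 i) (up i * d.1 0 i) + c.
Proof.
move=> d0 Glu Gc; rewrite /dotT /dot lerD// (bigID P)/= [X in _ + X]big1 ?addr0.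
  by apply: ler_sum => i Pi; apply: ler_mul_max; apply: Glu.
by move=> i nPi; rewrite d0// mulr0.
Qed.

(** The tangent inequality for the convex function - f on the slice through a, which contains both a
    and b. *)
Lemma concave_tangent {R : realType} {n : nat} (z : {set 'I_n}) (w : bool)
    (S : set ('rV[R]_n * R)) (f : 'rV[R]_n * R -> R) (a b : 'rV[R]_n * R) :
  concave_in z w S f -> S a -> slice z w S a b -> differentiable f a ->
  f b - f a <= dotT (gradT f a) (b - a).
Proof.
move=> cf Sa Sb df.
have dN : differentiable (- f) a by apply: differentiableN.
have := convex_tangent (cf a Sa) _ Sb (diff_derivable dN).
move=> /(_ (And3 Sa (fun _ _ => erefl) (or_intror erefl))).
rewrite deriveN; last exact: diff_derivable.
by rewrite derive_dotT// lerNl opprB opprK addrC.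
Qed.

(* Go from [p] to [(x, t)] through the point which has only the concave
   variables moved: the tangent bound applies to the first leg, and the mean
   value theorem with the Lipschitz constants to the second. *)
Lemma le_upper_est {R : realType} {n : nat} (f : 'rV[R]_n * R -> R)
    (S : set ('rV[R]_n * R)) (q : gradest R n) (s : shape n) (l : lips R n)
    (p : 'rV[R]_n * R) (x : 'rV[R]_n) (t v : R) :
  (forall (a d : 'rV[R]_n * R) (c : R), S a -> S (a + d) ->
     0 <= c <= 1 -> S (a + c *: d)) ->
  (forall a, S a -> differentiable f a) ->
  shape_correct s S f -> lips_bound l S f -> grad_bracket q f p ->
  S p -> S (x, t) -> S (mixv (zset s) x p.1, p.2) ->
  S (mixv (zset s) x p.1, t) -> p.2 <= t -> f p <= v ->
  f (x, t) <= upper_est v q s l p x t.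
Proof.
move=> cvxS df [ccv jccv] lb [qu qt] Sp Sxt Sm Smt pt fpv.
pose z := zset s; pose m := mixv z x p.1.
(* Time moves on the first leg exactly when concavity is joint with time, and on the second leg
   otherwise; this yields the two alternatives of [drift]. *)
pose b : 'rV[R]_n * R := (m, if joint s then t else p.2).
have Sb : S b by rewrite /b; case: ifP.
have leg1 : f b - f p <=
    \sum_(i in z) Num.max ((g_lo q p).1 0 i * (x 0 i - p.1 0 i))
                          ((g_up q p).1 0 i * (x 0 i - p.1 0 i))
    + (joint s)%:R * (g_up q p).2 * (t - p.2).
  have /le_trans : f b - f p <= dotT (gradT f p) (b - p).
    apply: (@concave_tangent _ _ z (joint s) S); last 1 first.
    - exact: df.
    - by case: (joint s) jccv => // /(_ isT).
    - exact: Sp.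
    - split => //; first by move=> i iz; rewrite /b/= mxE (negbTE iz).
      by rewrite /b; case: ifP; [left|right].
  apply; have -> : \sum_(i in z) Num.max ((g_lo q p).1 0 i * (x 0 i - p.1 0 i))
                          ((g_up q p).1 0 i * (x 0 i - p.1 0 i)) =
     \sum_(i in z) Num.max ((g_lo q p).1 0 i * (b - p).1 0 i)
                          ((g_up q p).1 0 i * (b - p).1 0 i).
    by apply: eq_bigr => i iz; rewrite !mxE/= iz.
  apply: dotT_le_max => [i iz|i _|].
  - by rewrite !mxE /= (negbTE iz) subrr.
  - exact: qu.
  - rewrite /b/=; case: (joint s); rewrite ?mul0r ?subrr ?mulr0// mul1r.
    by rewrite ler_wpM2r ?subr_ge0//; case/andP: qt.
have leg2 : f (x, t) - f b <=
    \sum_(i | i \notin z) Num.max (lo_u l i * (x 0 i - p.1 0 i))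
                                  (up_u l i * (x 0 i - p.1 0 i))
    + (1 - (joint s)%:R) * up_t l * (t - p.2).
  have bd : b + ((x, t) - b) = (x, t) by rewrite addrC subrK.
  (* The whole second leg must stay in S, since the mean value point is not known and the Lipschitz
     constants are valid only on S. *)
  have Sc (c : R) : 0 <= c <= 1 -> S (b + c *: ((x, t) - b)).
    by apply: cvxS; rewrite ?bd.
  have [c c01] := mean_value_segment (fun c c01 => df _ (Sc c c01)).
  rewrite bd => ->; rewrite derive_dotT; last exact/df/Sc.
  have [lu lt] := lb _ (Sc c c01).
  have -> : \sum_(i | i \notin z) Num.max (lo_u l i * (x 0 i - p.1 0 i))
                                  (up_u l i * (x 0 i - p.1 0 i)) =
     \sum_(i | i \notin z) Num.max (lo_u l i * ((x, t) - b).1 0 i)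
                                  (up_u l i * ((x, t) - b).1 0 i).
    by apply: eq_bigr => i iz; rewrite !mxE/= (negbTE iz).
  apply: dotT_le_max => [i iz|i _|].
  - by rewrite !mxE/= (negbNE iz) subrr.
  - by have /andP[/ltW -> /ltW ->] := lu i.
  - move: lt; rewrite /b/=; case: (joint s) => /andP[_ lt].
      by rewrite !subrr mulr0 !mul0r.
    by rewrite mulr0n subr0 mul1r ler_wpM2r// subr_ge0.
rewrite /upper_est /drift; move: leg1 leg2; rewrite -/z; lra.
Qed.

(** * Boxes, Euclidean balls and the back-off bound *)

Lemma box_convex {R : realType} {n : nat} (a b x d : 'rV[R]_n) (c : R) :
  box a b x -> box a b (x + d) -> 0 <= c <= 1 -> box a b (x + c *: d).
Proof.
move=> [ax xb] [axd xdb] /andP[c0 c1].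
by split=> i; move: (ax i) (xb i) (axd i) (xdb i); rewrite !mxE => *; nra.
Qed.

Lemma box_mixv {R : realType} {n : nat} (z : {set 'I_n})
    (a b x y : 'rV[R]_n) :
  box a b x -> box a b y -> box a b (mixv z x y).
Proof. by move=> [ax xb] [ay yb]; split=> i; rewrite mxE; case: ifP. Qed.

Lemma bbox_sub_box {R : realType} {n : nat} (A : set 'rV[R]_n)
    (a b : 'rV[R]_n) :
  A `<=` box a b -> bbox A `<=` box a b.
Proof. by move=> Aab; apply: smallest_sub => //; exists a, b. Qed.

(** [bbox A] is the intersection of the boxes containing A, so it inherits closure properties shared
    by all boxes. *)
Lemma bbox_convex {R : realType} {n : nat} (A : set 'rV[R]_n)
    (x d : 'rV[R]_n) (c : R) :
  bbox A x -> bbox A (x + d) -> 0 <= c <= 1 -> bbox A (x + c *: d).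
Proof.
move=> Ax Axd c01 B BA; case: (BA) => -[a [b Bab]] _.
have := Ax _ BA; have := Axd _ BA; rewrite Bab => ? ?.
exact: box_convex.
Qed.

Lemma bbox_mixv {R : realType} {n : nat} (z : {set 'I_n}) (A : set 'rV[R]_n)
    (x y : 'rV[R]_n) :
  bbox A x -> bbox A y -> bbox A (mixv z x y).
Proof.
move=> Ax Ay B BA; case: (BA) => -[a [b Bab]] _.
by have := Ax _ BA; have := Ay _ BA; rewrite Bab => ? ?; apply: box_mixv.
Qed.

Lemma norm2_ge0 {R : realType} {n : nat} (v : 'rV[R]_n) : 0 <= norm2 v.
Proof. exact: sqrtr_ge0. Qed.

Lemma sqr_norm2 {R : realType} {n : nat} (v : 'rV[R]_n) :
  norm2 v ^+ 2 = \sum_i v 0 i ^+ 2.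
Proof. by rewrite sqr_sqrtr// sumr_ge0// => i _; rewrite sqr_ge0. Qed.

Lemma norm2_le {R : realType} {n : nat} (v : 'rV[R]_n) (r : R) :
  0 <= r -> (norm2 v <= r) = (\sum_i v 0 i ^+ 2 <= r ^+ 2).
Proof. by move=> r0; rewrite -sqr_norm2 ler_sqr// nnegrE norm2_ge0. Qed.

Lemma coord_le_norm2 {R : realType} {n : nat} (v : 'rV[R]_n) (i : 'I_n) :
  `|v 0 i| <= norm2 v.
Proof.
rewrite -ler_sqr ?nnegrE ?norm2_ge0// sqr_norm2 real_normK ?num_real//.
by rewrite (bigD1 i)//= lerDl sumr_ge0// => j _; rewrite sqr_ge0.
Qed.

(** The Cauchy-Schwarz inequality, by summing the squares of a_i |b| - b_i |a| once zero vectors are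
    set aside. *)
Lemma dot_le_norm2 {R : realType} {n : nat} (a b : 'rV[R]_n) :
  dot a b <= norm2 a * norm2 b.
Proof.
have coord0 (v : 'rV[R]_n) i : norm2 v = 0 -> v 0 i = 0.
  by move=> v0; apply/eqP; rewrite -normr_le0 -v0 coord_le_norm2.
have [a0|a0] := eqVneq (norm2 a) 0.
  by rewrite a0 mul0r /dot big1// => i _; rewrite coord0 ?mul0r.
have [b0|b0] := eqVneq (norm2 b) 0.
  by rewrite b0 mulr0 /dot big1// => i _; rewrite (coord0 b) ?mulr0.
have A0 : 0 < norm2 a by rewrite lt0r a0 norm2_ge0.
have B0 : 0 < norm2 b by rewrite lt0r b0 norm2_ge0.
set A := norm2 a in A0 *; set B := norm2 b in B0 *.
have AB0 : 0 < 2 * (A * B) by rewrite !mulr_gt0.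
rewrite -(ler_pM2l AB0) /dot mulr_sumr.
apply: (@le_trans _ _ (\sum_i (a 0 i ^+ 2 * B ^+ 2 + b 0 i ^+ 2 * A ^+ 2))).
  by apply: ler_sum => i _; have := sqr_ge0 (a 0 i * B - b 0 i * A); nra.
by rewrite big_split/= -!mulr_suml -!sqr_norm2 -/A -/B; nra.
Qed.

Lemma eball_center {R : realType} {n : nat} (c : 'rV[R]_n) (r : R) :
  0 <= r -> eball c r c.
Proof.
by move=> r0; rewrite /eball/= subrr norm2_le// big1 ?sqr_ge0// => i _;
  rewrite mxE expr0n.
Qed.

Lemma eball_convex {R : realType} {n : nat} (e x d : 'rV[R]_n) (r c : R) :
  0 <= r -> eball e r x -> eball e r (x + d) -> 0 <= c <= 1 ->
  eball e r (x + c *: d).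
Proof.
move=> r0; rewrite /eball/= !norm2_le// => xr xdr /andP[c0 c1].
apply: (@le_trans _ _ (\sum_i ((1 - c) * (x - e) 0 i ^+ 2
                               + c * (x + d - e) 0 i ^+ 2))).
  apply: ler_sum => i _; rewrite !mxE.
  have c1' : 0 <= 1 - c by rewrite subr_ge0.
  (* The gap between the two sides is exactly c (1 - c) d_i^2. *)
  by have := mulr_ge0 (mulr_ge0 c0 c1') (sqr_ge0 (d 0 i)); nra.
rewrite big_split/= -!mulr_sumr; nra.
Qed.

(** Mixing two arbitrary points could leave the ball; mixing with the centre only replaces
    coordinates of x - c by 0. *)
Lemma eball_mixv {R : realType} {n : nat} (z : {set 'I_n}) (c x : 'rV[R]_n)
    (r : R) :
  0 <= r -> eball c r x -> eball c r (mixv z x c).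
Proof.
move=> r0; rewrite /eball/= !norm2_le//; apply: le_trans.
apply: ler_sum => i _; rewrite !mxE; case: ifP => // _.
by rewrite subrr expr0n sqr_ge0.
Qed.

(** The purpose of the shrunk box: an excitation of size at most r about a point of it respects the
    original bounds. *)
Lemma eball_sub_box {R : realType} {n : nat} (a b c : 'rV[R]_n) (r : R) :
  box (a + const_mx r) (b - const_mx r) c -> eball c r `<=` box a b.
Proof.
move=> [ac cb] x xr; split=> i; move: (ac i) (cb i);
  have := le_trans (coord_le_norm2 (x - c) i) xr;
  rewrite !mxE ler_norml => /andP[]; lra.
Qed.

(** Each maximum is at most the back-off component times the absolute displacement, and
    Cauchy-Schwarz then removes x. The result is uniform over the ball, in the form of [Aval]. *)
Lemma upper_est_le_backoff {R : realType} {n : nat} (v : R) (q : gradest R n)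
    (s : shape n) (l : lips R n) (p : 'rV[R]_n * R) (x : 'rV[R]_n) (t r : R) :
  0 <= r -> eball p.1 r x ->
  upper_est v q s l p x t <=
    v + drift (joint s) (g_up q p).2 (up_t l) (t - p.2)
    + r * norm2 (backoff q s l p).
Proof.
move=> r0 xr; rewrite /upper_est -addrA lerD2l.
have max_abs (a b d : R) :
    Num.max (a * d) (b * d) <= Num.max `|a| `|b| * `|d|.
  rewrite ge_max; apply/andP; split; apply: le_trans (ler_norm _) _;
    by rewrite normrM ler_wpM2r// le_max lexx ?orbT.
pose d : 'rV[R]_n := \row_i `|(x - p.1) 0 i|.
have dr : norm2 d <= r.
  apply: le_trans xr; rewrite norm2_le ?norm2_ge0// sqr_norm2.
  by apply: ler_sum => i _; rewrite mxE real_normK ?num_real.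
apply: (@le_trans _ _ (dot (backoff q s l p) d)).
  rewrite /dot [leRHS](bigID (mem (zset s)))/=.
  by apply: lerD; apply: ler_sum => i iz; rewrite !mxE ?iz ?(negbTE iz) max_abs.
by rewrite (le_trans (dot_le_norm2 _ _))// mulrC ler_wpM2r// norm2_ge0.
Qed.

(** * Summing the violations *)

Lemma slack_series_le {R : realType} (D beta : R) (d v : nat -> R)
    (reduced : pred nat) :
  0 <= beta < 1 -> 0 < D -> beta <= (D - d 0%N) / D -> 0 <= d 0%N ->
  (forall m, d m.+1 = if reduced m then beta * d m else d m) ->
  (forall m, v m <= d m) -> (forall m, 0 < v m -> reduced m) ->
  (\sum_(0 <= m <oo) (Num.max 0 (v m))%:E <= D%:E)%E.
Proof.
move=> /andP[beta0 beta1] D0 betaD d0 dS vd vred.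
have d_ge0 m : 0 <= d m.
  by elim: m => // m IH; rewrite dS; case: ifP => // _; rewrite mulr_ge0.
have telescope m : (1 - beta) * Num.max 0 (v m) <= d m - d m.+1.
  rewrite dS; have [v0|v0] := leP (v m) 0.
    by rewrite mulr0; case: ifP => _; have := d_ge0 m; nra.
  by rewrite vred//; have := vd m; nra.
have partial m :
    (1 - beta) * (\sum_(0 <= i < m) Num.max 0 (v i)) <= d 0%N - d m.
  elim: m => [|m IH]; first by rewrite big_nil mulr0 subrr.
  by rewrite big_nat_recr//=; have := telescope m; nra.
(* The condition on the slack-reduction constant, cleared of its denominator. *)
have dD : d 0%N <= (1 - beta) * D.
  by move: betaD; rewrite ler_pdivlMr//; nra.
(* The terms are nonnegative, so the series converges in the extended reals and the bound on partial
   sums passes to the limit. *)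
apply: lime_le.
  by apply: is_cvg_nneseries => m _ _; rewrite lee_fin le_max lexx.
apply: nearW => m; rewrite sumEFin lee_fin.
have beta1' : 0 < 1 - beta by rewrite subr_gt0.
rewrite -(ler_pM2l beta1'); have := partial m; have := d_ge0 m; lra.
Qed.

(** * Times, reference points and inputs of a run *)

Lemma shrunk_box_sub {R : realType} {nu ngp ng : nat}
    (p : problem R nu ngp ng) :
  0 <= delta_e p -> shrunk_box p `<=` Ibox p.
Proof. by move=> e0 x /eball_sub_box; apply; apply: eball_center. Qed.

Lemma tau_le {R : realType} {nu ngp ng : nat} (p : problem R nu ngp ng)
    (r : run R nu ngp ng) (i k : nat) :
  times_ok p r -> (i <= k)%N -> tau r i <= tau r k.
Proof. by move=> [_ tauS _]; apply: (homo_leq lexx le_trans tauS). Qed.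

Lemma tau_ge0 {R : realType} {nu ngp ng : nat} (p : problem R nu ngp ng)
    (r : run R nu ngp ng) (k : nat) :
  times_ok p r -> tau0 p <= tau r k.
Proof. by move=> tok; have [<- _ _] := tok; apply: (tau_le tok). Qed.

Lemma ref_feas_sub {R : realType} {nu ngp ng : nat} (p : problem R nu ngp ng)
    (r : run R nu ngp ng) (k : nat) :
  ref_feas p r k `<=` kf p r k.
Proof. by rewrite /ref_feas => kb; case: (the_cost p) => [phi []|]. Qed.

Lemma kref_cases {R : realType} {nu ngp ng : nat} (p : problem R nu ngp ng)
    (r : run R nu ngp ng) (k : nat) :
  reference_rule p r k -> kf p r k (kref r k) \/ kref r k = 0%N.
Proof. by case=> [[/ref_feas_sub ? _]|[_ ?]]; [left|right]. Qed.

Lemma kref_le {R : realType} {nu ngp ng : nat} (p : problem R nu ngp ng)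
    (r : run R nu ngp ng) (k : nat) :
  reference_rule p r k -> (kref r k <= k)%N.
Proof. by case/kref_cases => [[]|->]. Qed.

Lemma kref_shrunk {R : realType} {nu ngp ng : nat} (p : problem R nu ngp ng)
    (r : run R nu ngp ng) (k : nat) :
  A2F p r -> reference_rule p r k -> shrunk_box p (u r (kref r k)).
Proof. by move=> [_ _ u0] /kref_cases[[]|->]. Qed.

(** Early termination returns the reference input; otherwise the shrunk box is among the constraints
    of the projection. *)
Lemma ubar_shrunk {R : realType} {nu ngp ng : nat} (p : problem R nu ngp ng)
    (r : run R nu ngp ng) (k : nat) :
  A2F p r -> reference_rule p r k -> algorithm3F p r k ->
  shrunk_box p (ubar r k).
Proof.
move=> a2 rr [s [_ [[_ ->]|[_ [Pl [_ _ [sphi [S [[]]]]]]]]]] //.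
exact: kref_shrunk.
Qed.

Lemma xK_convex {R : realType} {nu ngp ng : nat} (r : run R nu ngp ng)
    (k : nat) (K : R) (a b : 'rV[R]_nu) :
  box a b (u r (kref r k)) -> box a b (ubar r k) -> 0 <= K <= 1 ->
  box a b (xK r k K).
Proof.
by move=> bu bub K01; apply: box_convex => //; rewrite addrC subrK.
Qed.

Lemma next_input {R : realType} {nu ngp ng : nat} (p : problem R nu ngp ng)
    (r : run R nu ngp ng) (k : nat) :
  0 <= delta_e p -> step_rule p r k -> update_rule p r k ->
  (exists K, [/\ 0 <= K <= 1, u r k.+1 = xK r k K,
     forall j, Gval r k j K <= slack_p p r k.+1 j & F3 p r k K]) \/
  Be p r (kref r k) (u r k.+1).
Proof.
move=> e0 step [exc nexc].
have [/exc ->|/nexc] := pselect (exciting r k (xK r k (Kls r k)));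
  last by right.
case: step => [[[K01 [f1 _ f3 _]] _]|[_ [[K01 [f2 f3 _]] _]]|[_ _ ->]].
- by left; exists (Kls r k).
(* The back-off term in [F2'] is nonnegative, so [F2'] gives the bound on [Gval]. *)
- left; exists (Kls r k); split=> // j; apply: le_trans (f2 j).
  by rewrite lerDl mulr_ge0// norm2_ge0.
(* With K = 0 the next input is the reference itself, the centre of the ball. *)
- by right; rewrite /xK scale0r addr0; apply: eball_center.
Qed.

Lemma u_in_Ibox {R : realType} {nu ngp ng : nat} (p : problem R nu ngp ng)
    (r : run R nu ngp ng) (k : nat) :
  0 <= delta_e p -> A2F p r -> (forall k, reference_rule p r k) ->
  (forall k, algorithm3F p r k) -> (forall k, step_rule p r k) ->
  (forall k, update_rule p r k) -> Ibox p (u r k).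
Proof.
move=> e0 a2 rr al st up; case: k => [|k].
  by case: a2 => _ _; apply: shrunk_box_sub.
have [[K [K01 -> _ _]]|] := next_input e0 (st k) (up k).
  apply: shrunk_box_sub => //; apply: xK_convex => //.
  - exact: kref_shrunk.
  - exact: ubar_shrunk.
apply: eball_sub_box; exact: kref_shrunk.
Qed.

(** * [Aval] and [Gval] as upper bounds on the experimental constraints *)

Lemma C2_near_differentiable {R : realType} {V : normedModType R} (S : set V)
    (f : V -> R) (x : V) :
  C2_near S f -> S x -> differentiable f x.
Proof. by case=> O [_ SO [df _ _]] Sx; apply/df/SO. Qed.

Lemma Be_sub_Ibox {R : realType} {nu ngp ng : nat} (p : problem R nu ngp ng)
    (r : run R nu ngp ng) (kb : nat) :
  shrunk_box p (u r kb) -> Be p r kb `<=` Ibox p.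
Proof. exact: eball_sub_box. Qed.

Lemma timeint_convex {R : realType} (a b t d c : R) :
  timeint a b t -> timeint a b (t + d) -> 0 <= c <= 1 ->
  timeint a b (t + c * d).
Proof. by rewrite /timeint/= => /andP[? ?] /andP[? ?] /andP[? ?]; nra. Qed.

(** The two-leg estimate starts at the centre of the ball, so its turning point stays in [set_e];
    the back-off bound then makes it independent of x. *)
Lemma le_Aval {R : realType} {nu ngp ng : nat} (p : problem R nu ngp ng)
    (r : run R nu ngp ng) (k kb : nat) (j : 'I_ngp) (x : 'rV[R]_nu) :
  0 <= delta_e p -> times_ok p r -> A1F p -> A3 p r -> A4 p r ->
  gp p j (pt r kb) <= gp_up r k j (pt r kb) ->
  grad_bracket (gp_grad r k j) (gp p j) (pt r kb) ->
  (kb <= k)%N -> shrunk_box p (u r kb) -> Be p r kb x ->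
  gp p j (x, tau r k.+1) <= Aval p r k j kb.
Proof.
move=> e0 tok [_ a1 _] a3 a4 a5 a6 kbk ukb xB.
apply: le_trans (upper_est_le_backoff _ _ _ _ (p := pt r kb) _ e0 xB).
have tk : tau r kb <= tau r k.+1 by apply: (tau_le tok); apply: leqW.
have t1 : timeint (tau r kb) (tau r k.+1) (tau r kb).
  by rewrite /timeint/= lexx.
have t2 : timeint (tau r kb) (tau r k.+1) (tau r k.+1).
  by rewrite /timeint/= lexx andbT.
have [_ _ _ l3 _] := a3 j; have [_ _ s3 _] := a4 j.
apply: (le_upper_est (S := set_e p r k kb)) => //.
- move=> a d c [a1' a2'] [d1 d2] c01; split; first exact: eball_convex.
  exact: timeint_convex.
(* [set_e] lies in [Itau]: the ball is kept inside the bounds by the shrunk box, and the times lie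
   between [tau0] and [taubar]. *)
- move=> a [a1' /andP[a2' a3']]; apply: C2_near_differentiable (a1 j) _.
  split; first exact: Be_sub_Ibox a1'.
  rewrite /timeint/= (le_trans (tau_ge0 kb tok) a2')/=.
  by apply: le_trans a3' _; case: tok.
- exact: s3.
- by have [] := l3 _ _ kbk.
- by split => //; apply: eball_center.
- by split => //; apply: eball_mixv.
- by split => //; apply: eball_mixv.
Qed.

Lemma le_Gval {R : realType} {nu ngp ng : nat} (p : problem R nu ngp ng)
    (r : run R nu ngp ng) (k : nat) (j : 'I_ngp) (K : R) :
  times_ok p r -> A1F p -> A3 p r -> A4 p r ->
  (forall kb, (kb <= k)%N -> gp p j (pt r kb) <= gp_up r k j (pt r kb)) ->
  (forall kb, (kb <= k)%N ->
     grad_bracket (gp_grad r k j) (gp p j) (pt r kb)) ->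
  (forall kb, Ibox p (u r kb)) -> Ibox p (ubar r k) -> (kref r k <= k)%N ->
  0 <= K <= 1 -> gp p j (xK r k K, tau r k.+1) <= Gval r k j K.
Proof.
move=> tok [_ a1 _] a3 a4 a5 a6 uI ubI krk K01.
suff est kb : (kb <= k)%N -> gp p j (xK r k K, tau r k.+1) <=
    upper_est (gp_up r k j (pt r kb)) (gp_grad r k j) (shape_loc r k kb j)
      (lips_loc r k kb j) (pt r kb) (xK r k K) (tau r k.+1).
  rewrite /Gval; elim/big_ind: _ => [|y z yg zg|i _].
  (* The default value of the minimum is the estimate from index 0, itself one of the terms. *)
  - exact: est.
  - by rewrite le_min yg.
  - by apply: est; rewrite -ltnS.
move=> kbk.
have tk : tau r kb <= tau r k.+1 by apply: (tau_le tok); apply: leqW.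
set a := Num.min (tau r kb) (tau r (kref r k)).
have t1 : timeint a (tau r k.+1) (tau r kb).
  by rewrite /timeint/= tk andbT /a ge_min lexx.
have t2 : timeint a (tau r k.+1) (tau r k.+1).
  by rewrite /timeint/= lexx andbT /a ge_min tk.
pose A := [set u r kb; u r (kref r k); ubar r k].
have Abox x : A x -> bbox A x by move=> Ax B [_]; apply.
have ukbA : bbox A (u r kb) by apply: Abox; left; left.
have xKA : bbox A (xK r k K).
  (* The trial point lies between two of the points generating the bounding box. *)
  apply: bbox_convex => //; first by apply: Abox; left; right.
  by rewrite addrC subrK; apply: Abox; right.
have [_ l2 _ _ _] := a3 j; have [_ s2 _ _] := a4 j.
apply: (le_upper_est (S := set_loc r k kb)) => //.
- move=> b d c [b1 b2] [d1 d2] c01; split; first exact: bbox_convex.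
  exact: timeint_convex.
- move=> b [b1 /andP[b2 b3]]; apply: C2_near_differentiable (a1 j) _.
  split.
    apply: bbox_sub_box b1 => x [[->|->]|->];
      [exact: uI|exact: uI|exact: ubI].
  rewrite /timeint/= (le_trans _ b2) /=.
    by apply: le_trans b3 _; case: tok.
  by rewrite le_min !(tau_ge0 _ tok).
- exact: s2.
- by have [] := l2 _ _ kbk.
- by apply: a6.
- by split => //; apply: bbox_mixv.
- by split => //; apply: bbox_mixv.
- exact: a5.
Qed.

(** * Constraint values stay below the slacks *)

Lemma slack_p_ge0 {R : realType} {nu ngp ng : nat} (p : problem R nu ngp ng)
    (r : run R nu ngp ng) (k : nat) (j : 'I_ngp) :
  constants_ok p -> 0 <= slack_p p r k j.
Proof.
move=> [_ /(_ j)[d0 /andP[b0 _] _] _ _ _].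
by elim: k => //= k IH; case: ifP => // _; rewrite mulr_ge0.
Qed.

Lemma slack_ge0 {R : realType} {nu ngp ng : nat} (p : problem R nu ngp ng)
    (r : run R nu ngp ng) (k : nat) (j : 'I_ng) :
  constants_ok p -> 0 <= slack p r k j.
Proof.
move=> [_ _ /(_ j)[d0 /andP[b0 _] _] _ _].
by elim: k => //= k IH; case: ifP => // _; rewrite mulr_ge0.
Qed.

Lemma le_gmax {R : realType} {nu ngp ng : nat} (p : problem R nu ngp ng)
    (B : set 'rV[R]_nu) (j : 'I_ng) (x : 'rV[R]_nu) (c : R) :
  B x -> (gmax p B j <= c%:E)%E -> g p j x <= c.
Proof.
move=> Bx; rewrite -lee_fin; apply: le_trans.
by apply: ereal_sup_ubound; exists x.
Qed.

Lemma gp_le_slack {R : realType} {nu ngp ng : nat} (p : problem R nu ngp ng)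
    (r : run R nu ngp ng) (j : 'I_ngp) (k : nat) :
  constants_ok p -> times_ok p r -> A1F p -> A2F p r -> A3 p r -> A4 p r ->
  (forall k kb, (kb <= k)%N -> gp p j (pt r kb) <= gp_up r k j (pt r kb)) ->
  (forall k kb, (kb <= k)%N ->
     grad_bracket (gp_grad r k j) (gp p j) (pt r kb)) ->
  (forall k, reference_rule p r k) -> (forall k, algorithm3F p r k) ->
  (forall k, step_rule p r k) -> (forall k, update_rule p r k) ->
  gp p j (pt r k) <= slack_p p r k j.
Proof.
move=> cok tok a1 a2 a3 a4 a5 a6 rr al st up.
have e0 : 0 <= delta_e p by case: cok => /ltW.
have [neg _ u0] := a2.
(* Covers both the initial input and the fallback to u_0: [A2F] makes the constraint negative there
   at all times, while slacks are nonnegative. *)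
have in_B0 m v : Be p r 0 v -> gp p j (v, tau r m) <= slack_p p r m j.
  move=> vB; apply: le_trans (slack_p_ge0 _ _ _ cok); apply/ltW/neg => //.
  by rewrite (tau_ge0 _ tok)/=; case: tok.
case: k => [|k]; first by apply: in_B0; apply: eball_center.
(* Iteration k works with the slack of index k+1, which is the index of the input it produces. *)
have [[K [K01 uE GK _]]|uB] := next_input e0 (st k) (up k).
  rewrite /pt uE; apply: le_trans (GK j).
  apply: (le_Gval tok a1 a3 a4) => //.
  - by move=> kb; apply: a5.
  - by move=> kb; apply: a6.
  - by move=> kb; apply: u_in_Ibox.
  - by apply: shrunk_box_sub => //; apply: ubar_shrunk.
  - exact: kref_le (rr k).
have [[krk Ak _ ks]|k0] := kref_cases (rr k); last by apply: in_B0; rewrite -k0.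
apply: le_trans (Ak j).
by apply: le_Aval => //; [apply: a5|apply: a6].
Qed.

Lemma g_le_slack {R : realType} {nu ngp ng : nat} (p : problem R nu ngp ng)
    (r : run R nu ngp ng) (j : 'I_ng) (k : nat) :
  constants_ok p -> A2F p r -> (forall k, reference_rule p r k) ->
  (forall k, step_rule p r k) -> (forall k, update_rule p r k) ->
  g p j (u r k) <= slack p r k j.
Proof.
move=> cok [_ neg u0] rr st up.
have e0 : 0 <= delta_e p by case: cok => /ltW.
have in_B0 m v : Be p r 0 v -> g p j v <= slack p r m j.
  by move=> vB; apply: le_trans (slack_ge0 _ _ _ cok); apply: neg.
case: k => [|k]; first by apply: in_B0; apply: eball_center.
have [[K [K01 -> _ /(_ j)]]|uB] := next_input e0 (st k) (up k).
  (* [F3] bounds the maximum over a ball centred at the new input. *)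
  by apply: le_gmax; apply: eball_center.
have [[_ _ /(_ j) gk _]|k0] := kref_cases (rr k); last first.
  by apply: in_B0; rewrite -k0.
exact: le_gmax gk.
Qed.

(** The assumptions give one null set per triple of indices; finitely many constraints and countably
    many iterations allow a single null set for all of them. *)
Lemma ae_forall_le {R : realType} {d : measure_display}
    {Omega : measurableType d} (Pr : probability Omega R) (I : finType)
    (Q : I -> nat -> nat -> Omega -> Prop) :
  (forall i k kb, (kb <= k)%N -> {ae Pr, forall w, Q i k kb w}) ->
  {ae Pr, forall w, forall i k kb, (kb <= k)%N -> Q i k kb w}.
Proof.
move=> Qae; apply: filter_forall => i.
apply/ae_foralln => k; apply/ae_foralln => kb.
have [kbk|] := boolP (kb <= k)%N; last by move=> _; apply: aeW.
by apply: filterS (Qae i k kb kbk).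
Qed.

Theorem theorem4 (R : realType) (nu ngp ng : nat)
    (d : measure_display) (Omega : measurableType d) (Pr : probability Omega R)
    (p : problem R nu ngp ng) (X : Omega -> run R nu ngp ng)
    (Hconst : constants_ok p)
    (Htimes : forall w, times_ok p (X w))
    (H1 : A1F p)
    (H2 : forall w, A2F p (X w))
    (H3 : forall w, A3 p (X w))
    (H4 : forall w, A4 p (X w))
    (H5 : A5 Pr p X)
    (H6 : A6 Pr p X)
    (Href : forall w k, reference_rule p (X w) k)
    (Halg : forall w k, algorithm3F p (X w) k)
    (Hstep : forall w k, step_rule p (X w) k)
    (Hupd : forall w k, update_rule p (X w) k)
    (Hbeta_p : forall j, beta_p p j <= (dS_p p j - dbar_p p j) / dS_p p j)
    (Hbeta : forall j, beta p j <= (dS p j - dbar p j) / dS p j) :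
  {ae Pr, forall w,
    (forall j, (\sum_(0 <= kb <oo)
        (Num.max 0 (gp p j (u (X w) kb, tau (X w) kb)))%:E
          <= (dS_p p j)%:E)%E) /\
    (forall j, (\sum_(0 <= kb <oo)
        (Num.max 0 (g p j (u (X w) kb)))%:E <= (dS p j)%:E)%E)} /\
  (forall w k, vle (uL p) (u (X w) k) /\ vle (u (X w) k) (uU p)).
Proof.
have e0 : 0 <= delta_e p by case: Hconst => /ltW.
(* The bounds on the inputs hold for every realization; only the sums need the almost sure event. *)
split; last by move=> w k; apply: u_in_Ibox.
apply: filterS2 (ae_forall_le H5) (ae_forall_le H6) => w h5 h6.
have [_ cp c _ _] := Hconst; split=> j.
- have [d0 b01 D0] := cp j.
  apply: (@slack_series_le _ _ (beta_p p j) (fun k => slack_p p (X w) k j) _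
    (fun k => 0 < gp_up (X w) k j (pt (X w) k))) => // k.
    by apply: gp_le_slack => // k' kb; [apply: h5|apply: h6].
  (* A positive true value forces a positive upper bound, by [A5] at kb = k, so every actual
     violation triggers a slack reduction. *)
  by move=> /lt_le_trans; apply; apply: h5.
- have [d0 b01 D0] := c j.
  apply: (@slack_series_le _ _ (beta p j) (fun k => slack p (X w) k j) _
    (fun k => 0 < g p j (u (X w) k))) => // k.
  exact: g_le_slack.
Qed.
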